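(* Let $V\subset\mathbb{R}^n$ be a nonempty polytope separated from the origin by a hyperplane. Consider the problem of finding the sphere with center $c$ and radius $r$ which encloses $V$ and minimizes $r/|c|$, and let $(c^*,r^* )$ be the parameters of the optimal sphere. Then the optimal value of the problem $$\min_{q\in\operatorname{co}(V)}\ \max_{x\in V}\frac{|q-x|}{|x|}$$ is $\gamma^* := r^*/|c^*|$, and the optimal point is $q^* := (1-(\gamma^* )^2)\,c^*$.
   Context: $|\cdot|$ is the Euclidean norm and $\operatorname{co}(V)$ is the convex hull of $V$. ''$V$ is separated from the origin by a hyperplane'' means strict separation, i.e. $0\notin\operatorname{co}(V)$. The sphere with center $c\in\mathbb{R}^n\setminus\{0\}$ and radius $r\ge0$ encloses $V$ if $|x-c|\le r$ for all $x\in V$. *)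

(* Defs.v *)
From mathcomp Require Import all_boot all_order all_algebra.
From mathcomp Require Import all_classical all_reals.
From mathcomp Require Import convex.

Set Implicit Arguments.
Unset Strict Implicit.
Unset Printing Implicit Defensive.

Import Order.TTheory GRing.Theory Num.Theory.

Local Open Scope classical_set_scope.
Local Open Scope ring_scope.

(* The canonical norm of 'rV[R]_n in MathComp-Analysis is the sup norm, so the
   Euclidean one is defined here. *)
Definition enorm (R : realType) (n : nat) (x : 'rV[R]_n) : R :=
  Num.sqrt (\sum_(i < n) x 0 i ^+ 2).

Definition co (R : realType) (n : nat) (A : set 'rV[R]_n) : set 'rV[R]_n :=
  smallest (@convex_set R 'rV[R]_n) A.

Definition polytope (R : realType) (n : nat) (V : set 'rV[R]_n) : Prop :=
  exists S : set 'rV[R]_n, finite_set S /\ V = co S.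

Definition encloses (R : realType) (n : nat)
    (c : 'rV[R]_n) (r : R) (V : set 'rV[R]_n) : Prop :=
  [/\ c != 0, 0 <= r & forall x, V x -> enorm (x - c) <= r].

Definition optimal_sphere (R : realType) (n : nat)
    (V : set 'rV[R]_n) (c : 'rV[R]_n) (r : R) : Prop :=
  encloses c r V /\
  forall (c' : 'rV[R]_n) (r' : R),
    encloses c' r' V -> r / enorm c <= r' / enorm c'.

Definition is_max (R : realType) (A : set R) (m : R) : Prop :=
  A m /\ ubound A m.

Definition is_min (R : realType) (A : set R) (m : R) : Prop :=
  A m /\ lbound A m.

Definition rel_errors (R : realType) (n : nat)
    (V : set 'rV[R]_n) (q : 'rV[R]_n) : set R :=
  [set enorm (q - x) / enorm x | x in V].

(* [sup] is a total function with a default value; it denotes the maximum over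
   V only when [is_max (rel_errors V q) (max_rel_error V q)] holds. *)
Definition max_rel_error (R : realType) (n : nat)
    (V : set 'rV[R]_n) (q : 'rV[R]_n) : R :=
  sup (rel_errors V q).

(* Main.v *)
(* For gamma = r / |c| < 1 and q = (1 - gamma^2) c, the conditions |x - c| <= r and
   |q - x| <= gamma |x| are equivalent: squared, they differ by the factor
   1 - gamma^2. So enclosing spheres of ratio gamma < 1 correspond to points of
   relative error at most gamma. The point of V closest to 0 has relative error
   below 1; a minimizer over V exists by compactness; it minimizes over the whole
   space because projecting onto V decreases all distances to points of V; it is
   unique by the parallelogram law. *)
Require Import Defs.
From mathcomp Require Import all_boot all_order all_algebra.
From mathcomp Require Import all_classical all_reals.
From mathcomp Require Import interval_inference.
From mathcomp Require Import topology normedtype convex derive realfun.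
From mathcomp Require Import ring lra.

Import numFieldNormedType.Exports.
Import Order.TTheory GRing.Theory Num.Theory.

Local Open Scope classical_set_scope.
Local Open Scope ring_scope.

(** * Euclidean inner product and norm *)

Section Dot.
Context {R : realType} {n : nat}.
Implicit Types (u v w x : 'rV[R]_n) (a : R).

Definition dot u v : R := \sum_(i < n) u 0 i * v 0 i.

Lemma dotC u v : dot u v = dot v u.
Proof. by apply: eq_bigr => i _; rewrite mulrC. Qed.

Lemma dotDl u v w : dot (u + v) w = dot u w + dot v w.
Proof. by rewrite -big_split; apply: eq_bigr => i _; rewrite mxE mulrDl. Qed.

Lemma dotZl a u w : dot (a *: u) w = a * dot u w.
Proof. by rewrite mulr_sumr; apply: eq_bigr => i _; rewrite mxE mulrA. Qed.

Lemma dotNl u w : dot (- u) w = - dot u w.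
Proof. by rewrite -scaleN1r dotZl mulN1r. Qed.

Lemma dotDr u v w : dot u (v + w) = dot u v + dot u w.
Proof. by rewrite dotC dotDl !(dotC u). Qed.

Lemma dotZr a u w : dot u (a *: w) = a * dot u w.
Proof. by rewrite dotC dotZl dotC. Qed.

Lemma dotNr u w : dot u (- w) = - dot u w.
Proof. by rewrite dotC dotNl dotC. Qed.

Definition dotE := (dotDl, dotDr, dotZl, dotZr, dotNl, dotNr).

Lemma dot_ge0 u : 0 <= dot u u.
Proof. by apply: sumr_ge0 => i _; rewrite -expr2 sqr_ge0. Qed.

Lemma dot_eq0 u : (dot u u == 0) = (u == 0).
Proof.
apply/eqP/eqP => [u0|->]; last by rewrite /dot big1 // => i _; rewrite mxE mul0r.
apply/rowP => i; rewrite mxE; apply/eqP; rewrite -sqrf_eq0 expr2.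
by move/psumr_eq0P : u0 => -> // j _; rewrite -expr2 sqr_ge0.
Qed.

Lemma dot_gt0 u : (0 < dot u u) = (u != 0).
Proof. by rewrite lt_def dot_ge0 andbT dot_eq0. Qed.

Lemma dot_continuous (T : topologicalType) (f g : T -> 'rV[R]_n) :
  continuous f -> continuous g -> continuous (fun t => dot (f t) (g t)).
Proof.
move=> cf cg t; apply: (cvg_big (op := +%R)) => [|i _].
  exact: add_continuous.
apply: cvgM.
- exact: (continuous_comp (cf t) (@coord_continuous _ _ _ 0 i (f t))).
- exact: (continuous_comp (cg t) (@coord_continuous _ _ _ 0 i (g t))).
Qed.

Lemma enorm_ge0 u : 0 <= enorm u.
Proof. exact: sqrtr_ge0. Qed.

Lemma enormE u : enorm u = Num.sqrt (dot u u).
Proof. by congr Num.sqrt; apply: eq_bigr => i _; rewrite expr2. Qed.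

Lemma sqr_enorm u : enorm u ^+ 2 = dot u u.
Proof. by rewrite enormE sqr_sqrtr // dot_ge0. Qed.

Lemma enorm_gt0 u : (0 < enorm u) = (u != 0).
Proof. by rewrite enormE sqrtr_gt0 dot_gt0. Qed.

Lemma enorm_le u a : 0 <= a -> (enorm u <= a) = (dot u u <= a ^+ 2).
Proof. by move=> a0; rewrite -sqr_enorm ler_sqr ?nnegrE ?enorm_ge0. Qed.

Lemma enorm_continuous (T : topologicalType) (f : T -> 'rV[R]_n) :
  continuous f -> continuous (fun t => enorm (f t)).
Proof.
move=> cf t; under eq_fun do rewrite enormE.
apply: (@continuous_comp _ _ _ (fun t => dot (f t) (f t)) Num.sqrt).
  exact: dot_continuous.
exact: sqrt_continuous.
Qed.

End Dot.

(** * Convex hulls and compactness of polytopes *)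

Section Convex.
Context {R : realType} {n : nat}.
Implicit Types (V S : set 'rV[R]_n) (x y p : 'rV[R]_n).

(** Trades the bundled parameter in [{i01 R}] for a real [t] with two inequalities, so that computed
    weights can be supplied directly. *)
Lemma convex_setP V : @convex_set R 'rV[R]_n V <->
  forall x y t, V x -> V y -> 0 <= t -> t <= 1 -> V (t *: x + (1 - t) *: y).
Proof.
split=> [cV x y t Vx Vy t0 t1|cV x y t].
  pose t' : {i01 R} := Itv01 t0 t1.
  by have := cV x y t'; rewrite !inE; apply.
rewrite !inE => Vx Vy; exact: cV.
Qed.

Lemma convex_co S : @convex_set R 'rV[R]_n (co S).
Proof.
apply/convex_setP => x y t Sx Sy t0 t1 A [cA SA].
by move/convex_setP : (cA); apply => //; [exact: Sx|exact: Sy].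
Qed.

Lemma co_idem S : co (co S) = co S.
Proof. exact/smallest_id/convex_co. Qed.

Lemma co0 : co set0 = set0 :> set 'rV[R]_n.
Proof.
by apply: smallest_id; apply/convex_setP.
Qed.

Lemma co_set1 p : co [set p] = [set p].
Proof.
apply: smallest_id; apply/convex_setP => x y t -> -> _ _ /=.
by rewrite -scalerDl addrC subrK scale1r.
Qed.

(** The segments from [p] to points of [co S] already form a convex set. With [S] empty the right
    side would be empty, whereas the hull still contains [p]. *)
Lemma co_setU1 p S : S !=set0 ->
  co (p |` S) = [set z.1 *: z.2 + (1 - z.1) *: p | z in `[0, 1] `*` co S].
Proof.
move=> [s0 Ss0]; apply/seteqP; split.
- apply: smallest_sub; last first.
    move=> x [->|Sx].
      exists (0, s0) => /=; last by rewrite scale0r add0r subr0 scale1r.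
      by split => /=; [rewrite in_itv /= lexx ler01|exact: sub_gen_smallest].
    exists (1, x) => /=; last by rewrite subrr scale0r addr0 scale1r.
    by split => /=; [rewrite in_itv /= lexx ler01|exact: sub_gen_smallest].
  apply/convex_setP => _ _ t [[a x] /= [+ Sx] <-] [[b y] /= [+ Sy] <-] t0 t1.
  rewrite !in_itv /= => /andP[a0 a1] /andP[b0 b1].
  pose u := t * a + (1 - t) * b.
  have u0 : 0 <= u by rewrite addr_ge0 // mulr_ge0 // subr_ge0.
  have u1 : u <= 1 by rewrite /u; nra.
  (* [u] is the total weight on [co S]. If it vanishes, the combination is [p] itself; otherwise [x]
     and [y] are mixed with their weights normalized by [u]. *)
  have [uE|uN] := eqVneq u 0.
    have ta : t * a = 0 by rewrite /u in uE; nra.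
    have tb : (1 - t) * b = 0 by rewrite /u in uE; nra.
    exists (0, x); first by split => //=; rewrite in_itv /= lexx ler01.
    rewrite /= !scalerDr !scalerA ta tb !scale0r !add0r -scalerDl.
    by congr (_ *: p); lra.
  exists (u, (t * a / u) *: x + (1 - t * a / u) *: y).
    split => /=; first by rewrite in_itv /= u0.
    have upos : 0 < u by rewrite lt_def uN.
    move/convex_setP : (convex_co S); apply => //.
      by rewrite divr_ge0 // mulr_ge0.
    by rewrite ler_pdivrMr // mul1r /u; nra.
  by apply/rowP => i; rewrite !mxE /=; rewrite /u in uN *; field.
- move=> _ [[a x] /= [+ Sx] <-]; rewrite in_itv /= => /andP[a0 a1].
  move/convex_setP : (convex_co (p |` S)); apply => //.
    apply: (smallest_sub _ _ Sx); first exact: convex_co.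
    by move=> y Sy; apply: sub_gen_smallest; right.
  by apply: sub_gen_smallest; left.
Qed.

(** Induction on the generating points: each new point makes the hull a continuous image of the
    compact set [[0, 1]] times the previous hull. The induction effectively starts at one point,
    since [co_setU1] needs a nonempty set. *)
Lemma compact_co S : finite_set S -> compact (co S).
Proof.
move=> /finite_seqP[s ->]; elim: s => [|p s IH].
  by rewrite set_nil co0; exact: compact0.
have -> : [set` p :: s] = p |` [set` s].
  by apply/seteqP; split=> x /=; rewrite inE => /predU1P.
case: s IH => [_|q s IH].
  by rewrite set_nil setU0 co_set1; exact: compact_set1.
rewrite co_setU1; last by exists q; rewrite /= mem_head.
apply: continuous_compact; last exact: (compact_setX (@segment_compact R 0 1) IH).
apply: continuous_subspaceT => z.
apply: cvgD; apply: cvgZ.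
- exact: cvg_fst.
- exact: cvg_snd.
- by apply: cvgB; [exact: cvg_cst|exact: cvg_fst].
- exact: cvg_cst.
Qed.

End Convex.

(** * Relative errors and enclosing spheres for a compact convex set avoiding the origin *)

Section RelativeError.
Context {R : realType} {n : nat} (V : set 'rV[R]_n).
Implicit Types (q p x c : 'rV[R]_n) (g r : R).

(** The bound [g] on the relative error, squared and cleared of the quotient and the supremum; [q]
    may lie outside [V]. *)
Definition rel_bound q g :=
  0 <= g /\ forall x, V x -> dot (q - x) (q - x) <= g ^+ 2 * dot x x.

Lemma rel_bound_sphere c r : 0 <= r -> c != 0 -> r / enorm c < 1 ->
  encloses c r V <->
  rel_bound ((1 - (r / enorm c) ^+ 2) *: c) (r / enorm c).
Proof.
move=> r0 c0 g1; set g := r / enorm c in g1 *.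
have ec : 0 < enorm c by rewrite enorm_gt0.
have g0 : 0 <= g by rewrite divr_ge0 // ltW.
have rE : r ^+ 2 = g ^+ 2 * dot c c.
  by rewrite -sqr_enorm -exprMn /g divfK // gt_eqF.
(* With q = (1 - g^2) c and r = g|c|, g^2 |x|^2 - |q - x|^2 = (1 - g^2)(r^2 - |x - c|^2). *)
have key x : (dot ((1 - g ^+ 2) *: c - x) ((1 - g ^+ 2) *: c - x)
    <= g ^+ 2 * dot x x) = (enorm (x - c) <= r).
  rewrite enorm_le // rE -subr_ge0 -[RHS]subr_ge0 -[RHS](@pmulr_rge0 _ (1 - g ^+ 2)).
    by congr (0 <= _); rewrite !dotE (dotC c x); ring.
  by rewrite subr_gt0 expr_lt1.
split=> [[_ _ H]|[_ H]]; split=> // x Vx; first by rewrite key H.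
by rewrite -key H.
Qed.

Hypotheses (V_compact : compact V) (V_convex : @convex_set R 'rV[R]_n V).
Hypotheses (V_neq0 : V !=set0) (V0 : ~ V 0).

Let V_gt0 x : V x -> 0 < dot x x.
Proof. by move=> Vx; rewrite dot_gt0; apply/eqP => x0; apply: V0; rewrite -x0. Qed.

(** At the point [p] of [V] nearest to [q], the vectors q - p and x - p form no acute angle, and
    expanding |q - x|^2 around [p] gives the inequality. *)
Lemma closest_point q : exists2 p, V p &
  forall x, V x ->
    dot (p - x) (p - x) <= dot (q - x) (q - x) - dot (q - p) (q - p).
Proof.
have [|p] := compact_EVT_min
  (f := fun x : 'rV[R]_n => dot (q - x) (q - x)) V_neq0 V_compact.
  have cB : continuous (fun x : 'rV[R]_n => q - x).
    by move=> x; apply: continuousB; [exact: cst_continuous|exact: cvg_id].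
  exact: (continuous_subspaceT (dot_continuous _ _ _ cB cB)).
rewrite inE => Vp pmin; exists p => // x Vx.
(* Minimality of [p] against points of the segment from [p] to [x]: the right side is the change of
   the squared distance to [q]. *)
have Hv t : 0 <= t -> t <= 1 ->
    0 <= t * (t * dot (x - p) (x - p) - 2 * dot (q - p) (x - p)).
  move=> t0 t1; have Vt : V (t *: x + (1 - t) *: p).
    exact: (convex_setP V).1 V_convex _ _ _ Vx Vp t0 t1.
  have := pmin (t *: x + (1 - t) *: p); rewrite inE => /(_ Vt).
  rewrite -subr_ge0; congr (0 <= _).
  rewrite !dotE (dotC x q) (dotC p q) (dotC x p); ring.
have : dot (q - p) (x - p) <= 0.
  rewrite leNgt; apply/negP => a0.
  move: (dot_ge0 (x - p)) (Hv) a0.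
  move: (dot (q - p) (x - p)) (dot (x - p) (x - p)) => a b b0 {}Hv a0.
  have ab : 0 < a + b by rewrite ltr_pwDl.
  (* For t = a / (a + b), t b <= a < 2 a, which contradicts [Hv]. *)
  have t0 : 0 < a / (a + b) by rewrite divr_gt0.
  have := Hv (a / (a + b)) (ltW t0); rewrite ler_pdivrMr // mul1r lerDl => /(_ b0).
  rewrite pmulr_rge0 // leNgt => /negP; apply.
  rewrite subr_lt0 mulrAC ltr_pdivrMr //; nra.
rewrite !dotE (dotC x q) (dotC p q) (dotC x p); lra.
Qed.

Lemma norm_max : exists2 M, 0 < M & forall x, V x -> dot x x <= M.
Proof.
have [|m] := @compact_EVT_max _ R (fun x => dot x x) V V_neq0 V_compact.
  have cid : continuous (fun x : 'rV[R]_n => x) by move=> x; exact: cvg_id.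
  exact: (continuous_subspaceT (dot_continuous _ _ _ cid cid)).
rewrite inE => Vm mM; exists (dot m m); first exact: V_gt0.
by move=> x Vx; apply: mM; rewrite inE.
Qed.

Lemma rel_bound_lt1 : exists q g, [/\ V q, rel_bound q g & g < 1].
Proof.
have [M M0 VM] := norm_max.
have [p Vp Hp] := closest_point 0; exists p.
have pM : 0 <= 1 - dot p p / M by rewrite subr_ge0 ler_pdivrMr // mul1r VM.
(* For [p] nearest to 0, |p - x|^2 <= |x|^2 - |p|^2, and |p|^2 >= (|p|^2 / M) |x|^2 because |x|^2 <=
   M. *)
exists (Num.sqrt (1 - dot p p / M)); split=> //.
  split=> [|x Vx]; first exact: sqrtr_ge0.
  rewrite sqr_sqrtr //; apply: le_trans (Hp x Vx) _.
  rewrite !sub0r !dotE !opprK mulrBl mul1r lerB // mulrAC ler_pdivrMr //.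
  by rewrite ler_wpM2l ?dot_ge0 ?VM.
rewrite -[ltRHS]sqrtr1 ltr_sqrt ?ltr01 // gtrBl divr_gt0 //; exact: V_gt0.
Qed.

(** Needed because the point obtained from an enclosing sphere is not known to lie in [V]. *)
Lemma rel_bound_proj q g : rel_bound q g -> exists2 p, V p & rel_bound p g.
Proof.
move=> [g0 Hg]; have [p Vp Hp] := closest_point q; exists p => //; split=> // x Vx.
apply: le_trans (Hp x Vx) _; apply: le_trans (Hg x Vx).
by rewrite gerBl dot_ge0.
Qed.

(** The coordinate [g] is minimized over the feasible pairs (q, g) in [V] times [[0, 1]], a compact
    set cut out by closed conditions. Projection extends minimality to all of space. *)
Lemma min_rel_bound : exists q g, [/\ V q, rel_bound q g, g < 1 &
  forall q' g', rel_bound q' g' -> g <= g'].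
Proof.
have [q0 [g0 [Vq0 Hq0 g01]]] := rel_bound_lt1.
pose C x := [set z : 'rV[R]_n * R |
  dot (z.1 - x) (z.1 - x) - z.2 ^+ 2 * dot x x <= 0].
pose P := (V `*` `[0, 1]) `&` \bigcap_(x in V) C x.
have P_rel q g : P (q, g) <-> [/\ V q, g <= 1 & rel_bound q g].
  rewrite /P /C /=; split=> [[[/= Vq +] H]|[Vq g1 [gge0 H]]].
    rewrite in_itv /= => /andP[gge0 g1]; split=> //; split=> // x /H /=.
    by rewrite subr_le0.
  split; first by split; rewrite //= in_itv /= gge0.
  by move=> x /H /=; rewrite subr_le0.
have cP : compact P.
  apply: compact_closedI.
    exact: (compact_setX V_compact (@segment_compact R 0 1)).
  apply: closed_bigI => x Vx; apply: (preimage_closed _ (@closed_le R 0)) => z _.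
  apply: cvgB.
    apply: (@dot_continuous R n _ (fun z : 'rV[R]_n * R => z.1 - x)) => {}z;
      by apply: cvgB; [exact: cvg_fst|exact: cvg_cst].
  by apply: cvgM; [apply: cvgM; exact: cvg_snd|exact: cvg_cst].
have P0 : P !=set0 by exists (q0, g0); apply/P_rel; split=> //; exact: ltW.
have [|[q g]] := @compact_EVT_min _ R snd P P0 cP.
  by apply: continuous_subspaceT => z; exact: cvg_snd.
rewrite inE => /P_rel[Vq g1 Hq] /= gmin.
have gg0 : g <= g0.
  by apply: (gmin (q0, g0)); rewrite inE; apply/P_rel; split=> //; exact: ltW.
exists q, g; split=> //; first exact: le_lt_trans g01.
move=> q' g' /rel_bound_proj[p Vp Hp].
have [g'1|g'1] := leP g' 1; last by apply: le_trans gg0 _; lra.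
by apply: (gmin (p, g')); rewrite inE; apply/P_rel.
Qed.

(* The midpoint of two distinct minimizers would do strictly better. *)
Lemma min_rel_bound_unique q q' g : rel_bound q g -> rel_bound q' g ->
  (forall p g', rel_bound p g' -> g <= g') -> q = q'.
Proof.
move=> [g0 Hq] [_ Hq'] gmin; apply/eqP; rewrite -subr_eq0 -dot_eq0.
rewrite eq_le dot_ge0 andbT leNgt; apply/negP => d0.
have [M M0 VM] := norm_max.
(* The midpoint gains |q - q'|^2 / 4 in squared distance; dividing by [M] makes this a uniform gain
   relative to |x|^2. *)
pose d := dot (q - q') (q - q') / (4 * M).
have dpos : 0 < d by rewrite divr_gt0 // mulr_gt0.
pose m := 2^-1 *: (q + q').
have Hm x : V x -> dot (m - x) (m - x) <= (g ^+ 2 - d) * dot x x.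
  move=> Vx; rewrite mulrBl.
  have -> : dot (m - x) (m - x) = 2^-1 * dot (q - x) (q - x)
      + 2^-1 * dot (q' - x) (q' - x) - dot (q - q') (q - q') / 4.
    rewrite /m !dotE (dotC x q) (dotC x q') (dotC q' q); lra.
  have : d * dot x x <= dot (q - q') (q - q') / 4.
    rewrite /d invfM mulrA -mulrA ler_piMr //; first by rewrite divr_ge0 // ltW.
    by rewrite mulrC ler_pdivrMr // mul1r VM.
  move: (Hq x Vx) (Hq' x Vx); lra.
(* Evaluating [Hm] at a point of [V] shows that the square root below is not the default value 0. *)
have gd : 0 <= g ^+ 2 - d.
  have [x Vx] := V_neq0.
  rewrite -(pmulr_lge0 _ (V_gt0 x Vx)); exact: le_trans (dot_ge0 _) (Hm x Vx).
have /gmin : rel_bound m (Num.sqrt (g ^+ 2 - d)).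
  by split=> [|x Vx]; [exact: sqrtr_ge0|rewrite sqr_sqrtr // Hm].
apply/negP; rewrite -ltNge -[ltRHS]ger0_norm // -sqrtr_sqr ltr_sqrt; nra.
Qed.

(** The quotient is continuous on the compact set [V], where |x| does not vanish, so the supremum is
    attained. *)
Lemma max_rel_error_is_max q : is_max (rel_errors V q) (max_rel_error V q).
Proof.
have [|m] := @compact_EVT_max _ R (fun x => enorm (q - x) / enorm x) V V_neq0 V_compact.
  have cB : continuous (fun x : 'rV[R]_n => q - x).
    by move=> x; apply: continuousB; [exact: cst_continuous|exact: cvg_id].
  have cid : continuous (fun x : 'rV[R]_n => x) by move=> x; exact: cvg_id.
  apply: continuous_in_subspaceT => x; rewrite inE => Vx.
  apply: (@continuousM R _ (fun y : 'rV[R]_n => enorm (q - y)) (fun y => (enorm y)^-1)).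
    exact: (enorm_continuous _ _ cB x).
  apply: (@continuousV R _ (@enorm R n)); last exact: (enorm_continuous _ _ cid x).
  by rewrite gt_eqF // enorm_gt0 -dot_gt0 V_gt0.
rewrite inE => Vm mM.
have ub : ubound (rel_errors V q) (enorm (q - m) / enorm m).
  by move=> _ [x Vx <-]; apply: mM; rewrite inE.
have Em : rel_errors V q (enorm (q - m) / enorm m) by exists m.
suff -> : max_rel_error V q = enorm (q - m) / enorm m by split.
apply/eqP; rewrite eq_le; apply/andP; split.
  by apply: ge_sup => //; eexists; exact: Em.
by apply: ub_le_sup => //; eexists; exact: ub.
Qed.

Lemma rel_boundE q g : rel_bound q g <-> max_rel_error V q <= g.
Proof.
have [[m Vm mE] ub] := max_rel_error_is_max q.
have E0 : 0 <= max_rel_error V q by rewrite -mE divr_ge0 ?enorm_ge0.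
have sq x g' : V x -> 0 <= g' ->
    (enorm (q - x) / enorm x <= g') = (dot (q - x) (q - x) <= g' ^+ 2 * dot x x).
  move=> Vx g'0; have ex : 0 < enorm x by rewrite enorm_gt0 -dot_gt0 V_gt0.
  by rewrite ler_pdivrMr // enorm_le ?mulr_ge0 ?(ltW ex) // exprMn sqr_enorm.
split=> [[g0 H]|Eg]; first by rewrite -mE sq // H.
split=> [|x Vx]; first exact: le_trans Eg.
rewrite -sq //; last exact: le_trans Eg.
by apply: le_trans Eg; apply: ub; exists x.
Qed.

(** The minimizer [q] and its value [g] determine the optimal sphere by inverting q = (1 - g^2)
    c. *)
Lemma optimal_sphereE : exists q g, [/\ V q, 0 <= g < 1,
  max_rel_error V q = g /\ (forall p, g <= max_rel_error V p),
  forall p, max_rel_error V p <= g <-> p = q &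
  forall c r, optimal_sphere V c r <->
    c = (1 - g ^+ 2)^-1 *: q /\ r = g * enorm c].
Proof.
have [q [g [Vq Hq g1 gmin]]] := min_rel_bound.
have g0 : 0 <= g by case: Hq.
have gle p : g <= max_rel_error V p by apply: (gmin p); apply/rel_boundE.
have Eq : max_rel_error V q = g.
  by apply/eqP; rewrite eq_le gle andbT; apply/rel_boundE.
have uniq p : max_rel_error V p <= g <-> p = q.
  split=> [/rel_boundE Hp|->]; last by rewrite Eq.
  exact: min_rel_bound_unique Hp Hq gmin.
have h0 : 0 < 1 - g ^+ 2 by rewrite subr_gt0 expr_lt1.
exists q, g; rewrite g0; split=> //.
pose c := (1 - g ^+ 2)^-1 *: q.
have q0 : q != 0 by rewrite -dot_gt0 V_gt0.
have c0 : c != 0 by rewrite scaler_eq0 negb_or q0 invr_eq0 gt_eqF.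
have ec : 0 < enorm c by rewrite enorm_gt0.
have gE : g * enorm c / enorm c = g by rewrite mulfK // gt_eqF.
have qE : (1 - g ^+ 2) *: c = q by rewrite scalerA divff ?scale1r // gt_eqF.
have enc : encloses c (g * enorm c) V.
  apply/rel_bound_sphere; rewrite ?gE ?qE // mulr_ge0 // ltW //.
have low c' r' : encloses c' r' V -> g <= r' / enorm c'.
  move=> H; have [c'0 r'0 _] := H.
  (* Ratios of at least 1 fall outside the correspondence, but they exceed [g] anyway. *)
  have [r1|r1] := leP 1 (r' / enorm c'); first exact: le_trans (ltW g1) r1.
  by move/(rel_bound_sphere _ _ r'0 c'0 r1) : H => /gmin.
move=> c' r'; split=> [[H opt]|[-> ->]]; last first.
  by split=> // c2 r2; rewrite gE; exact: low.
have [c'0 r'0 _] := H.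
(* Comparison with the sphere built from [q] forces ratio [g]; uniqueness of the minimizer then
   fixes the center. *)
have g'E : r' / enorm c' = g.
  by apply/eqP; rewrite eq_le low // andbT -[leRHS]gE; exact: opt.
have r'1 : r' / enorm c' < 1 by rewrite g'E.
move/(rel_bound_sphere _ _ r'0 c'0 r'1) : H; rewrite g'E => /rel_boundE/uniq <-.
rewrite scalerA mulVf ?scale1r ?gt_eqF //; split=> //.
by rewrite -g'E divfK // gt_eqF // enorm_gt0.
Qed.

End RelativeError.

(** * Specialization to polytopes, which are compact and equal to their own hull *)

Theorem lemma9 (R : realType) (n : nat) (V : set 'rV[R]_n)
    (V_polytope : polytope V) (V_nonempty : V !=set0)
    (V_separated : ~ co V 0) :
  (exists! s : 'rV[R]_n * R, optimal_sphere V s.1 s.2) /\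
  (forall q, co V q -> is_max (rel_errors V q) (max_rel_error V q)) /\
  (forall (c : 'rV[R]_n) (r : R), optimal_sphere V c r ->
     let gamma := r / enorm c in
     is_min [set max_rel_error V q | q in co V] gamma /\
     (forall q,
        (co V q /\
         forall q', co V q' -> max_rel_error V q <= max_rel_error V q') <->
        q = (1 - gamma ^+ 2) *: c)).
Proof.
have [S [finS VE]] := V_polytope.
have coV : co V = V by rewrite VE co_idem.
have V_convex : @convex_set R 'rV[R]_n V by rewrite VE; exact: convex_co.
have V_compact : compact V by rewrite VE; exact: compact_co.
rewrite coV in V_separated *.
have [q [g [Vq /andP[g0 g1] [Eq gle] uniq opt]]] :=
  optimal_sphereE V V_compact V_convex V_nonempty V_separated.
split; [|split].
- exists ((1 - g ^+ 2)^-1 *: q, g * enorm ((1 - g ^+ 2)^-1 *: q)).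
  by split=> [|[c r] /= /opt[-> ->] //]; apply/opt.
- by move=> p _; exact: max_rel_error_is_max.
move=> c r /opt[cE rE] gamma.
have h0 : 1 - g ^+ 2 != 0 by rewrite gt_eqF // subr_gt0 expr_lt1.
(* Cancelling |c| requires c != 0, which holds because [q] lies in [V] and 0 does not. *)
have gE : gamma = g.
  rewrite /gamma rE mulfK // gt_eqF // enorm_gt0 cE scaler_eq0 negb_or invr_eq0 h0 /=.
  by apply/eqP => q0; apply: V_separated; rewrite -q0.
rewrite gE cE scalerA divff // scale1r; split.
  by split=> [|_ [p _ <-] //]; exists q.
move=> p; split=> [[Vp pmin]|->]; first by apply/uniq; rewrite -Eq; exact: pmin.
by split=> // p' _; rewrite Eq.
Qed.
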